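(* Let $X$ be an $n$-dimensional space of real-valued functions on a set, $Y\subset X$ an $m$-dimensional subspace with $m<n$, and let $\Phi^m=[\Phi^m_1,\ldots,\Phi^m_m]$ and $\Phi^n=[\Phi^n_1,\ldots,\Phi^n_n]$ be affine bases of $Y$ and $X$, respectively. (1) If $\Phi^m=\Phi^nE$ for some real $n\times m$ matrix $E$, then $E$ is row affine. (2) If, moreover, $E(s,:)$ is invertible for some injective map $s:\{1,\ldots,m\}\to\{1,\ldots,n\}$, then the dual basis $D^m=\Phi^mE(s,:)^{-1}$ of $Y$ (the basis satisfying $\lambda_{s(i)}D^m_j=\delta_{ij}$ for $1\le i,j\le m$) exists and is affine.
   Context: A basis $\Phi=[\Phi_1,\ldots,\Phi_n]$ (a row vector of functions) of a finite-dimensional function space is affine if $\sum_i\Phi_i(t)=1$ for all $t$ in the common domain. A real matrix $E$ is row affine if $\sum_jE(i,j)=1$ for all $i$. $\lambda_1,\ldots,\lambda_n\in X^*$ denote the functionals dual to $\Phi^n$, i.e. $\lambda_i\Phi^n_j=\delta_{ij}$. $E(s,:)$ is the $m\times m$ matrix with entries $E(s(i),j)$. $\Phi^m=\Phi^nE$ means $\Phi^m_j=\sum_i\Phi^n_iE(i,j)$. *)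

(* Defs.v *)
From mathcomp Require Import all_boot all_order all_algebra.
From mathcomp Require Import boolp functions reals.

Set Implicit Arguments.
Unset Strict Implicit.
Unset Printing Implicit Defensive.

Import GRing.Theory.
Local Open Scope ring_scope.

(* R^o (convertible to R) carries the R-module structure that makes the
   functions T -> R^o an R-module. *)
Section FunctionSpaces.
Variables (R : realType) (T : Type).
Implicit Types X : {pred T -> R^o}.

Definition lin_comb n (Phi : 'I_n -> T -> R^o) (c : 'I_n -> R) : T -> R^o :=
  \sum_(i < n) c i *: Phi i.

Definition is_basis n X (Phi : 'I_n -> T -> R^o) : Prop :=
  [/\ forall i, Phi i \in X,
      forall c, lin_comb Phi c = 0 -> forall i, c i = 0
    & forall f, f \in X -> exists c, f = lin_comb Phi c].

Definition is_fun_space (n : nat) X : Prop :=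
  submod_closed X /\ exists Phi : 'I_n -> T -> R^o, is_basis X Phi.

Definition affine_family n (Phi : 'I_n -> T -> R^o) : Prop :=
  forall t : T, \sum_(i < n) Phi i t = 1.

Definition basis_mulmx n m (Phi : 'I_n -> T -> R^o) (E : 'M[R]_(n, m)) :
    'I_m -> T -> R^o :=
  fun j => lin_comb Phi (fun i => E i j).

(* An element of X^* is represented by a function on all of T -> R^o; its
   values outside X are irrelevant and unconstrained. *)
Definition linear_on X (l : (T -> R^o) -> R) : Prop :=
  forall a f g, f \in X -> g \in X -> l (a *: f + g) = a * l f + l g.

Definition biorthogonal n (l : 'I_n -> (T -> R^o) -> R)
    (Phi : 'I_n -> T -> R^o) : Prop :=
  forall i j, l i (Phi j) = (i == j)%:R.

Definition dual_functionals n X (Phi : 'I_n -> T -> R^o)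
    (l : 'I_n -> (T -> R^o) -> R) : Prop :=
  (forall i, linear_on X (l i)) /\ biorthogonal l Phi.

End FunctionSpaces.

Definition row_affine (R : realType) n m (E : 'M[R]_(n, m)) : Prop :=
  forall i, \sum_(j < m) E i j = 1.

(* Main.v *)
(* Since Phi^n is independent, comparing the coefficients of Phi^n E and Phi^n
   in the constant function 1 shows that Phi^n E is affine iff E fixes the
   all-ones column vector. The latter property passes from E to its row
   selection E(s,:), and then to the inverse of E(s,:). *)
Require Import Defs.
From mathcomp Require Import all_boot all_order all_algebra.
From mathcomp Require Import boolp functions reals.

Import GRing.Theory.
Local Open Scope ring_scope.

Lemma lin_combE (R : realType) (T : Type) n (Phi : 'I_n -> T -> R^o) c t :
  lin_comb Phi c t = \sum_(i < n) c i * Phi i t.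
Proof. by rewrite /lin_comb fct_sumE. Qed.

Lemma eq_lin_comb (R : realType) (T : Type) n (Phi : 'I_n -> T -> R^o) c d :
  c =1 d -> lin_comb Phi c = lin_comb Phi d.
Proof. by move=> eq_cd; apply: eq_bigr => i _; rewrite eq_cd. Qed.

Lemma lin_comb_delta (R : realType) (T : Type) n (Phi : 'I_n -> T -> R^o) j :
  lin_comb Phi (fun i => (i == j)%:R) = Phi j.
Proof.
rewrite /lin_comb (bigD1 j) //= eqxx scale1r big1 ?addr0 // => i /negPf ->.
by rewrite scale0r.
Qed.

Lemma lin_comb_mulmx (R : realType) (T : Type) n m (Phi : 'I_n -> T -> R^o)
    (A : 'M[R]_(n, m)) c :
  lin_comb (basis_mulmx Phi A) c =
  lin_comb Phi (fun i => \sum_(j < m) A i j * c j).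
Proof.
apply: funext => t; rewrite !lin_combE.
under eq_bigr do rewrite /basis_mulmx lin_combE mulr_sumr.
rewrite exchange_big; apply: eq_bigr => i _; rewrite mulr_suml.
by apply: eq_bigr => j _; rewrite mulrA [c j * _]mulrC.
Qed.

Lemma basis_mulmxA (R : realType) (T : Type) n m p (Phi : 'I_n -> T -> R^o)
    (A : 'M[R]_(n, m)) (B : 'M[R]_(m, p)) :
  basis_mulmx (basis_mulmx Phi A) B = basis_mulmx Phi (A *m B).
Proof.
apply: funext => j; rewrite /basis_mulmx lin_comb_mulmx.
by apply: eq_lin_comb => i; rewrite mxE.
Qed.

Lemma lin_comb_in (R : realType) (T : Type) n (X : {pred T -> R^o})
    (Phi : 'I_n -> T -> R^o) c :
  submod_closed X -> (forall i, Phi i \in X) -> lin_comb Phi c \in X.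
Proof.
move=> [X0 XD] PhiX; rewrite /lin_comb.
by elim/big_rec: _ => // i f _ fX; apply: XD.
Qed.

Lemma linear_on_lin_comb (R : realType) (T : Type) n (X : {pred T -> R^o})
    (Phi : 'I_n -> T -> R^o) l c :
    submod_closed X -> linear_on X l -> (forall i, Phi i \in X) ->
  l (lin_comb Phi c) = \sum_(i < n) c i * l (Phi i).
Proof.
move=> [X0 XD] l_lin PhiX; rewrite /lin_comb.
(* [linear_on] does not state that [l] preserves zero. Taking [a = -1] and [f = g = 0] gives
   [l 0 = - l 0 + l 0], which vanishes. *)
have l0 : l 0 = 0.
  by have := l_lin (-1) 0 0 X0 X0; rewrite scaler0 addr0 mulN1r addNr.
(* Since [l] is linear only on [X], the induction on partial sums must carry their membership in [X]
   along with the value of [l]. *)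
pose K (f : T -> R^o) (x : R) := f \in X /\ l f = x.
suff [] : K (\sum_(i < n) c i *: Phi i) (\sum_(i < n) c i * l (Phi i)) by [].
apply: (big_rec2 K) => [|i x f _ [fX <-]]; first by split.
by split; [apply: XD | apply: l_lin].
Qed.

Lemma biorthogonal_coef (R : realType) (T : Type) n (X : {pred T -> R^o})
    (Phi : 'I_n -> T -> R^o) l c i :
    submod_closed X -> (forall i, Phi i \in X) -> (forall i, linear_on X (l i)) ->
  biorthogonal l Phi -> l i (lin_comb Phi c) = c i.
Proof.
move=> subX PhiX l_lin lPhi; rewrite (linear_on_lin_comb _ _ _ X) //.
rewrite (bigD1 i) //= lPhi eqxx mulr1 big1 ?addr0 // => j ji.
by rewrite lPhi eq_sym (negPf ji) mulr0.
Qed.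

(** Biorthogonality of [Phi] makes [l i] the [i]-th coordinate over [Phi]. The coordinates of
    [Psi j] are therefore Kronecker deltas, the same as those of [Phi j]. *)
Lemma dual_basis_unique (R : realType) (T : Type) n (X : {pred T -> R^o})
    (Phi Psi : 'I_n -> T -> R^o) l :
    submod_closed X -> (forall i, linear_on X (l i)) ->
    is_basis X Phi -> biorthogonal l Phi ->
    (forall i, Psi i \in X) -> biorthogonal l Psi ->
  Psi = Phi.
Proof.
move=> subX l_lin [PhiX _ genPhi] lPhi PsiX lPsi; apply: funext => j.
have [c Psi_c] := genPhi _ (PsiX j).
rewrite Psi_c -[RHS]lin_comb_delta; apply: eq_lin_comb => i.
by rewrite -lPsi Psi_c (biorthogonal_coef _ _ _ X).
Qed.

(** Coordinates [c] over the new family correspond to coordinates [A c] over [Phi], and [c] to [A c]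
    is a bijection. Injectivity gives independence, surjectivity gives generation. *)
Lemma is_basis_mulmx (R : realType) (T : Type) n (X : {pred T -> R^o})
    (Phi : 'I_n -> T -> R^o) (A : 'M[R]_n) :
    submod_closed X -> is_basis X Phi -> A \in unitmx ->
  is_basis X (basis_mulmx Phi A).
Proof.
move=> subX [PhiX freePhi genPhi] uA; split=> [j|c|f /genPhi[c ->]].
- exact: lin_comb_in.
- rewrite lin_comb_mulmx => /freePhi Ac0 i.
  have /(congr1 (mulmx (invmx A))) : A *m (\col_j c j) = 0.
    apply/colP => k; rewrite !mxE -[RHS](Ac0 k).
    by apply: eq_bigr => j _; rewrite mxE.
  by rewrite mulKmx // mulmx0 => /colP/(_ i); rewrite !mxE.
- exists (fun i => (invmx A *m \col_j c j) i 0); rewrite lin_comb_mulmx.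
  apply: eq_lin_comb => i.
  have /colP/(_ i) := mulKVmx uA (\col_j c j).
  by rewrite !mxE => <-.
Qed.

(** Row sums become a matrix product, so that an inverse matrix can be cancelled against them. *)
Lemma row_affineP (R : realType) n m (E : 'M[R]_(n, m)) :
  row_affine E <-> E *m const_mx 1 = const_mx 1 :> 'cV_n.
Proof.
have rowE i : (E *m const_mx 1 : 'cV_n) i 0 = \sum_(j < m) E i j.
  by rewrite mxE; apply: eq_bigr => j _; rewrite mxE mulr1.
split=> [affE|E1 i]; last by rewrite -rowE E1 mxE.
by apply/colP => i; rewrite rowE mxE.
Qed.

Lemma row_affine_invmx (R : realType) n (A : 'M[R]_n) :
  A \in unitmx -> row_affine A -> row_affine (invmx A).
Proof. by move=> uA /row_affineP A1; apply/row_affineP; rewrite -{1}A1 mulKmx. Qed.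

Lemma sum_basis_mulmx (R : realType) (T : Type) n m (Phi : 'I_n -> T -> R^o)
    (E : 'M[R]_(n, m)) t :
  \sum_(j < m) basis_mulmx Phi E j t =
  \sum_(i < n) (\sum_(j < m) E i j) * Phi i t.
Proof.
under eq_bigr do rewrite /basis_mulmx lin_combE.
by rewrite exchange_big; apply: eq_bigr => i _; rewrite mulr_suml.
Qed.

Lemma affine_family_mulmx (R : realType) (T : Type) n m (X : {pred T -> R^o})
    (Phi : 'I_n -> T -> R^o) (E : 'M[R]_(n, m)) :
    is_basis X Phi -> affine_family Phi ->
  affine_family (basis_mulmx Phi E) <-> row_affine E.
Proof.
move=> [_ freePhi _] affPhi; split=> [affE i|affE t]; last first.
  rewrite sum_basis_mulmx -[RHS](affPhi t).
  by apply: eq_bigr => i _; rewrite affE mul1r.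
apply/eqP; rewrite -subr_eq0; apply/eqP.
(* These are the coordinates over [Phi] of the difference between the sum of the family [Phi E] and
   the sum of [Phi]. Both sums are the constant 1, so the combination is zero. *)
apply: (freePhi (fun i => \sum_j E i j - 1)); apply: funext => t.
rewrite lin_combE; under eq_bigr do rewrite mulrBl mul1r.
by rewrite sumrB -sum_basis_mulmx affE affPhi subrr.
Qed.

Theorem theorem3p5 (R : realType) (T : Type) (n m : nat)
    (X Y : {pred T -> R^o})
    (Phin : 'I_n -> T -> R^o) (Phim : 'I_m -> T -> R^o)
    (X_dim : is_fun_space n X) (Y_dim : is_fun_space m Y)
    (Y_sub_X : {subset Y <= X}) (m_lt_n : (m < n)%N)
    (Phim_basis : is_basis Y Phim) (Phim_affine : affine_family Phim)
    (Phin_basis : is_basis X Phin) (Phin_affine : affine_family Phin)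
    (E : 'M[R]_(n, m)) (Phim_E : Phim = basis_mulmx Phin E) :
  row_affine E /\
  forall (lambda : 'I_n -> (T -> R^o) -> R) (s : 'I_m -> 'I_n),
    dual_functionals X Phin lambda -> injective s -> rowsub s E \in unitmx ->
    let Dm := basis_mulmx Phim (invmx (rowsub s E)) in
    [/\ is_basis Y Dm,
        biorthogonal (fun i => lambda (s i)) Dm,
        forall D : 'I_m -> T -> R^o, is_basis Y D ->
          biorthogonal (fun i => lambda (s i)) D -> D = Dm
      & affine_family Dm].
Proof.
have [subX _] := X_dim; have [subY _] := Y_dim; have [PhinX _ _] := Phin_basis.
have affE : row_affine E.
  by apply/(affine_family_mulmx _ _ _ _ X Phin); rewrite -?Phim_E.
split=> // lambda s [lin_lambda dual_lambda] _ uEs Dm.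
have affEs : row_affine (rowsub s E).
  by move=> i; rewrite -[RHS](affE (s i)); apply: eq_bigr => j _; rewrite mxE.
have Dm_basis : is_basis Y Dm by apply: is_basis_mulmx; rewrite ?unitmx_inv.
have Dm_dual : biorthogonal (fun i => lambda (s i)) Dm.
  (* Over [Phin], the family [Dm] has coordinate matrix [E *m invmx (rowsub s E)]. Applying
     [lambda (s i)] reads off its row [s i], which is row [i] of [rowsub s E *m invmx (rowsub s E)],
     the identity. *)
  move=> i j; rewrite /Dm Phim_E basis_mulmxA.
  rewrite (biorthogonal_coef _ _ _ X) //.
  have /matrixP/(_ i j) := mulmxV uEs.
  by rewrite mul_rowsub_mx mxE => ->; rewrite mxE.
split=> // [D [DY _ _] D_dual|].
  (* Uniqueness is applied inside [Y]: the functionals [lambda (s i)], linear on [X], restrict to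
     linear ones on [Y]. *)
  apply: (dual_basis_unique _ _ _ Y _ _ (fun i => lambda (s i))) => //
    i a f g fY gY.
  by apply: lin_lambda; apply: Y_sub_X.
(* The criterion that gave [affE] over [Phin] is now used in the other direction, over the affine
   basis [Phim] of [Y]. *)
by apply/(affine_family_mulmx _ _ _ _ Y) => //; apply: row_affine_invmx.
Qed.
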